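(* Let $N\ge1$, $M\in\mathbb{N}^*$, $s\in(0,M)$, $p\in[1,\infty)$. Let $(\rho_\varepsilon)_{\varepsilon>0}$ be a family of mollifiers of the form $\rho_\varepsilon(h)=\varepsilon^{-N}\rho(h/\varepsilon)$ with $\rho\in L^1(\mathbb{R}^N)$ satisfying $\int_{\mathbb{R}^N}\rho(z)|z|^{p(M-s)}\,\mathrm{d}z<\infty$. Then there exists a bounded family $(f_\varepsilon)_{\varepsilon>0}\subset L^p(\mathbb{R}^N)$ such that \[\limsup_{\varepsilon\downarrow0}\int_{\mathbb{R}^N}\int_{\mathbb{R}^N}\rho_\varepsilon(h)\frac{|\Delta_h^Mf_\varepsilon(x)|^p}{|h|^{sp}}\,\mathrm{d}x\,\mathrm{d}h<\infty,\] but which is not relatively compact in $L^p_{loc}(\mathbb{R}^N)$.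
   Context: Mollifiers: $\rho_\varepsilon\ge0$, $\int\rho_\varepsilon=1$, and $\lim_{\varepsilon\downarrow0}\int_{|z|\ge\delta}\rho_\varepsilon=0$ for all $\delta>0$. $\Delta_h^Mf(x):=\sum_{j=0}^M(-1)^{M-j}\binom{M}{j}f(x+jh)$. *)

(* Defs.v *)
From HB Require Import structures.
From mathcomp Require Import all_boot all_order all_algebra.
From mathcomp Require Import all_classical all_reals all_analysis.
Set Implicit Arguments. Unset Strict Implicit. Unset Printing Implicit Defensive.
Import Order.TTheory GRing.Theory Num.Theory.
Import numFieldNormedType.Exports.
Local Open Scope classical_set_scope.
Local Open Scope ring_scope.

(* R^N is represented by N.-tuple R, equipped (by MathComp-Analysis) with the
   product sigma-algebra generated by the coordinates, i.e. the Borel sets of R^N. *)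

Section RN.
Variable R : realType.

(* Lebesgue integral on R^N of a nonnegative (extended-real valued) function,
   as the iterated one-dimensional Lebesgue integral
     int f = \int dx_1 ... \int dx_N f(x_1,...,x_N).
   For nonnegative measurable f this is the Lebesgue integral on R^N (Tonelli). *)
Fixpoint iint (n : nat) : (n.-tuple R -> \bar R) -> \bar R :=
  match n return (n.-tuple R -> \bar R) -> \bar R with
  | 0 => fun f => f [tuple]
  | n'.+1 => fun f =>
      (\int[@lebesgue_measure R]_x iint (fun t : n'.-tuple R => f (cons_tuple x t)))%E
  end.

Variable N : nat.

Definition tadd (x y : N.-tuple R) : N.-tuple R :=
  [tuple tnth x i + tnth y i | i < N].
Definition tscale (a : R) (x : N.-tuple R) : N.-tuple R :=
  [tuple a * tnth x i | i < N].
Definition tnorm (x : N.-tuple R) : R := Num.sqrt (\sum_(i < N) tnth x i ^+ 2).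

Definition fdiff (M : nat) (h : N.-tuple R) (f : N.-tuple R -> R) (x : N.-tuple R) : R :=
  \sum_(j < M.+1) (-1) ^+ (M - j) * ('C(M, j))%:R * f (tadd x (tscale j%:R h)).

Definition moll (rho : N.-tuple R -> R) (eps : R) (h : N.-tuple R) : R :=
  eps ^- N * rho (tscale eps^-1 h).

Definition BBM_energy (rho : N.-tuple R -> R) (M : nat) (s p eps : R)
    (f : N.-tuple R -> R) : \bar R :=
  iint (fun h => iint (fun x =>
     (moll rho eps h * (`| fdiff M h f x | `^ p) / (tnorm h `^ (s * p)))%:E)).

End RN.

(* Main.v *)
Require Import Defs.
From HB Require Import structures.
From mathcomp Require Import all_boot all_order all_algebra.
From mathcomp Require Import all_classical all_reals all_analysis.
(* [measurable_realfun] is imported again, last, so that the canonical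
   sigma-algebra on [\bar R] is found. *)
From mathcomp Require Import measurable_realfun zify ring lra.
Set Implicit Arguments. Unset Strict Implicit. Unset Printing Implicit Defensive.
Import Order.TTheory GRing.Theory Num.Theory.
Import numFieldNormedType.Exports.
Local Open Scope classical_set_scope.
Local Open Scope ring_scope.

(** Take f_eps(x) = cos(lam x_1) prod_i (1 - x_i^2)_+^(M+1) with
    lam = eps^(-(M-s)/M).  Every directional derivative of order k <= M is
    bounded by (L lam |h|)^k, so |Delta_h^M f_eps| <= (L lam |h|)^M, and it
    vanishes unless some x + jh lies in [-1,1]^N.  Hence the integral in x of
    |Delta_h^M f_eps|^p is at most C (lam |h|)^(Mp), and after h = eps z the
    powers of eps cancel: the energy is at most a constant times the moment of rho.

    For the lack of compactness let d = f_eps - f_eps' with eps' fixed and eps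
    small, and shift by tau = pi/(2 lam) along the first axis.  Since
    |cos| + |sin| >= 1, the four values d(x + j tau), j = 0,...,3, cannot all be
    small, while f_eps' hardly changes over these shifts.  So
    f_eps - f_eps' stays away from 0 in L^p near the origin, and no sequence with
    eps -> 0 is Cauchy in L^p_loc. *)

(** * The iterated integral *)

Section Iint.
Variable R : realType.
Local Notation mu := (@lebesgue_measure R).
Local Open Scope ereal_scope.

(* The integral of a nonnegative function is a supremum over simple functions
   below it, so monotonicity holds without measurability. *)
Lemma ge0_le_integral_nonmeas d (T : measurableType d)
    (m : {measure set T -> \bar R}) (f g : T -> \bar R) :
  (forall x, 0 <= f x) -> (forall x, f x <= g x) ->
  \int[m]_x f x <= \int[m]_x g x.
Proof.
move=> f0 fg; have g0 x : 0 <= g x by exact: le_trans (f0 x) (fg x).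
rewrite !ge0_integralTE//; apply: le_ereal_sup => _ [h /= hf <-].
by exists h => // x; apply: le_trans (hf x) (fg x).
Qed.

Lemma iint_ge0 n (f : n.-tuple R -> \bar R) :
  (forall x, 0 <= f x) -> 0 <= iint f.
Proof.
elim: n f => [|n IH] f f0 /=; first exact: f0.
by apply: integral_ge0 => x _; apply: IH => t; exact: f0.
Qed.

Lemma le_iint n (f g : n.-tuple R -> \bar R) :
  (forall x, 0 <= f x) -> (forall x, f x <= g x) -> iint f <= iint g.
Proof.
elim: n f g => [|n IH] f g f0 fg /=; first exact: fg.
apply: ge0_le_integral_nonmeas => x; first by apply: iint_ge0 => t.
by apply: IH => t.
Qed.

Lemma eq_iint n (f g : n.-tuple R -> \bar R) : f =1 g -> iint f = iint g.
Proof. by move=> /funext ->. Qed.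

(** The parameter space [T] is arbitrary so that the induction can move the first coordinate into
    it, passing from [T] to [T * R]. Each step is then the measurability half of Tonelli's
    theorem. *)
Lemma measurable_iint_param n d (T : measurableType d)
    (f : T * n.-tuple R -> \bar R) :
  measurable_fun setT f -> (forall x, 0 <= f x) ->
  measurable_fun setT (fun x => iint (fun t => f (x, t))).
Proof.
elim: n d T f => [|n IH] d T f mf f0 /=.
  by apply: measurableT_comp => //; exact: measurable_fun_pair.
pose g (z : (T * R) * n.-tuple R) := f (z.1.1, cons_tuple z.1.2 z.2).
have m1 : measurable_fun setT (fun z : (T * R) * n.-tuple R => z.1).
  exact: measurable_fst.
have mg : measurable_fun setT g.
  apply: measurableT_comp => //; apply: measurable_fun_pair.
    exact: (measurableT_comp measurable_fst m1).
  apply: measurable_cons; last exact: measurable_snd.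
  exact: (measurableT_comp measurable_snd m1).
have g0 z : 0 <= g z by exact: f0.
have mG := IH _ _ _ mg g0.
apply: (@measurable_fun_fubini_tonelli_F _ _ T (measurableTypeR R) _ mu
  (fun z => iint (fun t => g (z, t))) mG) => z.
exact: iint_ge0.
Qed.

Lemma measurable_cons_tuple n :
  measurable_fun setT (fun z : R * n.-tuple R => (cons_tuple z.1 z.2 : n.+1.-tuple R)).
Proof. exact: measurable_cons. Qed.

Lemma measurable_comp_cons n (f : n.+1.-tuple R -> \bar R) x :
  measurable_fun setT f ->
  measurable_fun setT (fun t : n.-tuple R => f (cons_tuple x t)).
Proof.
move=> mf; apply: measurableT_comp => //.
exact: measurable_cons.
Qed.

Lemma measurable_iint_cons n (f : n.+1.-tuple R -> \bar R) :
  measurable_fun setT f -> (forall x, 0 <= f x) ->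
  measurable_fun setT (fun x : R => iint (fun t : n.-tuple R => f (cons_tuple x t))).
Proof.
move=> mf f0; apply: (@measurable_iint_param n _ _ (fun z : R * n.-tuple R => f (cons_tuple z.1 z.2))) => //.
by apply: measurableT_comp => //; exact: measurable_cons_tuple.
Qed.

Lemma iintZl n (k : R) (f : n.-tuple R -> \bar R) :
  measurable_fun setT f -> (forall x, 0 <= f x) -> (0 <= k)%R ->
  iint (fun x => k%:E * f x) = k%:E * iint f.
Proof.
move=> + + k0; elim: n f => [|n IH] f mf f0 //=.
rewrite -ge0_integralZl_EFin//; last 2 first.
- by move=> x _; apply: iint_ge0.
- exact: measurable_iint_cons.
apply: eq_integral => x _; apply: IH => //; exact: measurable_comp_cons.
Qed.

Lemma iintD n (f g : n.-tuple R -> \bar R) :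
  measurable_fun setT f -> (forall x, 0 <= f x) ->
  measurable_fun setT g -> (forall x, 0 <= g x) ->
  iint (fun x => f x + g x) = iint f + iint g.
Proof.
elim: n f g => [|n IH] f g mf f0 mg g0 //=.
rewrite -ge0_integralD//; last 4 first.
- by move=> x _; apply: iint_ge0.
- exact: measurable_iint_cons.
- by move=> x _; apply: iint_ge0.
- exact: measurable_iint_cons.
by apply: eq_integral => x _; apply: IH => //; exact: measurable_comp_cons.
Qed.

Lemma iint_sum n (I : Type) (r : seq I) (f : I -> n.-tuple R -> \bar R) :
  (forall i, measurable_fun setT (f i)) -> (forall i x, 0 <= f i x) ->
  iint (fun x => \sum_(i <- r) f i x) = \sum_(i <- r) iint (f i).
Proof.
move=> mf f0; elim: r => [|i r IH].
  rewrite big_nil; under eq_iint do rewrite big_nil.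
  elim: n {f mf f0} => [|n IH] //=.
  by under eq_integral do rewrite IH; rewrite integral0.
rewrite big_cons -IH -iintD//; first by under eq_iint do rewrite big_cons.
  exact: emeasurable_sum.
by move=> x; apply: sume_ge0.
Qed.

(** The volume of a cube. It serves for [[-1, 1]^N], which carries the supports, and for the small
    cube on which separation is proved. *)
Lemma iint_prod_indic n (A : set R) (a : R) : measurable A -> mu A = a%:E ->
  iint (fun x : n.-tuple R => (\prod_(i < n) \1_A (tnth x i))%:E) = (a ^+ n)%:E.
Proof.
move=> mA muA; have a0 : (0 <= a)%R by rewrite -lee_fin -muA.
have mi : measurable_fun setT (\1_A : R -> R) by exact: measurable_indic.
have mi' : measurable_fun setT (fun x : R => (\1_A x : R)%:E) by exact/measurable_EFinP.
elim: n => [|n IH] /=; first by rewrite big_ord0 expr0.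
transitivity (\int[mu]_x ((\1_A x)%:E * (a ^+ n)%:E)).
  apply: eq_integral => x _; rewrite -IH -iintZl//; last 2 first.
  - apply/measurable_EFinP; apply: measurable_prod => i _.
    apply: (measurableT_comp mi).
    exact: measurable_tnth.
  - by move=> t; rewrite lee_fin; apply: prodr_ge0.
  apply: eq_iint => t; rewrite -EFinM big_ord_recl; congr (_ * _)%:E.
  by apply: eq_bigr => i _; rewrite tnthS.
rewrite ge0_integralZr//; last by rewrite lee_fin exprn_ge0.
by rewrite integral_indic// setIT [X in X * _]muA -EFinM exprS.
Qed.

(** The pushforward of [mu] under [x -> a * x + b], multiplied by [a], agrees with [mu] on half-open
    intervals, so it is [mu] by uniqueness of Lebesgue measure. *)
Lemma integral_affine (a b : R) (f : R -> \bar R) : (0 < a)%R ->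
  measurable_fun setT f -> (forall x, 0 <= f x) ->
  \int[mu]_x f (a * x + b)%R = (a^-1)%:E * \int[mu]_x f x.
Proof.
move=> a0 mf f0.
pose phi (x : measurableTypeR R) : measurableTypeR R := (a * x + b)%R.
have mphi : measurable_fun setT phi.
  apply: measurable_funD => //; apply: measurable_funM => //.
pose nu_ : {measure set (measurableTypeR R) -> \bar R} :=
  mscale (NngNum (ltW a0)) (pushforward mu phi).
pose nu := nu_ mphi.
have nuE A : measurable A -> mu A = nu A.
  apply: lebesgue_measure_unique => _ [[c e] _ <-] /=.
  rewrite /nu /nu_ /mscale /=.
  rewrite [X in _ = _ * X](_ : _ = mu (phi @^-1` `]c, e]))//.
  have -> : phi @^-1` `]c, e] = `](a^-1 * (c - b))%R, (a^-1 * (e - b))%R]%classic.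
    apply/seteqP; split => x /=; rewrite !in_itv /= /phi => /andP[H1 H2];
      apply/andP; split.
    - by rewrite ltr_pdivrMl// ltrBlDr.
    - by rewrite ler_pdivlMl// lerBrDr.
    - by move: H1; rewrite ltr_pdivrMl// ltrBlDr.
    - by move: H2; rewrite ler_pdivlMl// lerBrDr.
  rewrite !lebesgue_measure_itv/= !lte_fin ltr_pM2l ?invr_gt0// ltrD2r.
  case: ifPn => _; last by rewrite mule0.
  by rewrite -!EFinB -EFinM; congr (_%:E); field; rewrite gt_eqF.
rewrite [in RHS](eq_measure_integral nu); last by move=> A mA _; exact: nuE.
rewrite ge0_integral_mscale// muleA -EFinM mulVf ?gt_eqF// mul1e.
by rewrite ge0_integral_pushforward.
Qed.

(** The head is written [1 * x + _] to match [integral_affine] with slope 1; [tscale_cons] keeps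
    [+ 0] for the same reason. *)
Lemma tadd_cons n (x : R) (t : n.-tuple R) (h : n.+1.-tuple R) :
  tadd (cons_tuple x t) h =
  cons_tuple (1 * x + tnth h ord0)%R (tadd t [tuple tnth h (lift ord0 i) | i < n]).
Proof.
apply: eq_from_tnth => i; rewrite tnth_mktuple.
case: (unliftP ord0 i) => [j|] ->; rewrite ?tnthS ?tnth0 ?mul1r//.
by rewrite !tnth_mktuple.
Qed.

Lemma tscale_cons n (a x : R) (t : n.-tuple R) :
  tscale a (cons_tuple x t) = cons_tuple (a * x + 0)%R (tscale a t).
Proof.
apply: eq_from_tnth => i; rewrite tnth_mktuple.
case: (unliftP ord0 i) => [j|] ->; rewrite ?tnthS ?tnth0 ?addr0//.
by rewrite !tnth_mktuple.
Qed.

Lemma iint_tadd n (f : n.-tuple R -> \bar R) (h : n.-tuple R) :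
  measurable_fun setT f -> (forall x, 0 <= f x) ->
  iint (fun x => f (tadd x h)) = iint f.
Proof.
elim: n f h => [|n IH] f h mf f0 /=; first by rewrite tuple0 [RHS](congr1 f (tuple0 _)).
have m : measurable_fun setT (fun x : R => iint (fun t => f (cons_tuple x t))).
  exact: measurable_iint_cons.
transitivity (\int[mu]_x iint (fun t => f (cons_tuple (1 * x + tnth h ord0)%R t))).
  apply: eq_integral => x _.
  rewrite -(IH (fun t => f (cons_tuple _ t)) [tuple tnth h (lift ord0 i) | i < n])//.
  - by apply: eq_iint => t; rewrite tadd_cons.
  - exact: measurable_comp_cons.
rewrite (@integral_affine 1%R (tnth h ord0) _ _ m)//.
  by rewrite invr1 mul1e.
by move=> x; apply: iint_ge0.
Qed.

Lemma iint_tscale n (a : R) (f : n.-tuple R -> \bar R) : (0 < a)%R ->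
  measurable_fun setT f -> (forall x, 0 <= f x) ->
  iint (fun x => f (tscale a x)) = (a ^- n)%:E * iint f.
Proof.
move=> a0; elim: n f => [|n IH] f mf f0 /=.
  by rewrite expr0 invr1 mul1e [LHS](congr1 f (tuple0 _)) [RHS](congr1 f (tuple0 _)).
have m : measurable_fun setT (fun x : R => iint (fun t => f (cons_tuple x t))).
  exact: measurable_iint_cons.
have i0 x : 0 <= iint (fun t => f (cons_tuple x t)) by apply: iint_ge0.
transitivity (\int[mu]_x ((a ^- n)%:E * iint (fun t => f (cons_tuple (a * x + 0)%R t)))).
  apply: eq_integral => x _.
  rewrite -IH//; last exact: measurable_comp_cons.
  by apply: eq_iint => t; rewrite tscale_cons.
rewrite ge0_integralZl_EFin//; last by rewrite invr_ge0 exprn_ge0// ltW.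
  rewrite (@integral_affine a 0%R _ a0 m)// muleA -EFinM; congr (_%:E * _).
  by rewrite exprS invfM mulrC.
apply: (measurableT_comp m); exact: measurable_funD.
Qed.

(** * Measurability and size of the vector operations and of the Euclidean norm *)

Lemma measurable_tadd n (h : n.-tuple R) :
  measurable_fun setT (fun x => tadd x h).
Proof.
apply/measurable_fun_tnthP => i; rewrite (_ : _ \o _ = (fun x => tnth x i + tnth h i)%R).
  by apply: measurable_funD => //; exact: measurable_tnth.
by apply/funext => x /=; rewrite tnth_mktuple.
Qed.

Lemma measurable_tscale n (a : R) :
  measurable_fun setT (fun x : n.-tuple R => tscale a x).
Proof.
apply/measurable_fun_tnthP => i; rewrite (_ : _ \o _ = (fun x => a * tnth x i)%R).
  by apply: measurable_funM => //; exact: measurable_tnth.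
by apply/funext => x /=; rewrite tnth_mktuple.
Qed.

Lemma measurable_tnorm n : measurable_fun setT (@tnorm R n).
Proof.
have ms : measurable_fun setT (Num.sqrt : R -> R).
  by apply: continuous_measurable_fun; exact: sqrt_continuous.
apply: (measurableT_comp ms); apply: measurable_sum => i; apply: measurable_funX; exact: measurable_tnth.
Qed.

Lemma tnorm_ge0 n (x : n.-tuple R) : (0 <= tnorm x)%R.
Proof. exact: sqrtr_ge0. Qed.

Lemma tnth_le_tnorm n (x : n.-tuple R) i : (`|tnth x i| <= tnorm x)%R.
Proof.
rewrite -sqrtr_sqr /tnorm ler_sqrt; last by apply: sumr_ge0 => j _; exact: sqr_ge0.
by rewrite (bigD1 i)//= lerDl; apply: sumr_ge0 => j _; exact: sqr_ge0.
Qed.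

(** The crude bound [sqrt n <= n] is enough: it puts the unit cube inside the ball of radius [N]
    used to test local convergence. *)
Lemma tnorm_le_card n (x : n.-tuple R) :
  (forall i, `|tnth x i| <= 1)%R -> (tnorm x <= n%:R)%R.
Proof.
move=> x1; rewrite -[leRHS]ger0_norm// -sqrtr_sqr ler_sqrt ?sqr_ge0//.
apply: (@le_trans _ _ (\sum_(i < n) 1)%R).
  by apply: ler_sum => i _; rewrite -real_normK ?num_real// expr_le1.
rewrite sumr_const card_ord -natrX ler_nat.
by case: n {x x1} => // n; rewrite expnS expn1 leq_pmulr.
Qed.

Lemma tnorm_tscale n (a : R) (x : n.-tuple R) : (0 <= a)%R ->
  tnorm (tscale a x) = (a * tnorm x)%R.
Proof.
move=> a0; rewrite /tnorm -[in RHS](ger0_norm a0) -sqrtr_sqr -sqrtrM ?sqr_ge0//.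
by rewrite mulr_sumr; congr Num.sqrt; apply: eq_bigr => i _; rewrite tnth_mktuple exprMn.
Qed.

End Iint.

(** * Functions with geometrically bounded derivatives *)

Section DerivBounds.
Variable R : realType.

(* [phi] has derivatives up to order [k], the [j]-th one bounded by [A * L ^+ j]. *)
Fixpoint deriv_bounded (k : nat) (phi : R -> R) (A L : R) : Prop :=
  (forall t, `|phi t| <= A) /\
  if k is k'.+1 then
    exists2 dphi : R -> R, (forall t : R, is_derive t 1 phi (dphi t)) &
                           deriv_bounded k' dphi (A * L) L
  else True.

Lemma deriv_bounded_le0 k phi A L : deriv_bounded k phi A L ->
  forall t, `|phi t| <= A.
Proof. by case: k => [|k] []. Qed.

Lemma deriv_bounded_ge0 k phi A L : deriv_bounded k phi A L -> 0 <= A.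
Proof. by move=> /deriv_bounded_le0/(_ 0); apply: le_trans. Qed.

Lemma deriv_boundedS k phi A L :
  deriv_bounded k.+1 phi A L -> deriv_bounded k phi A L.
Proof.
elim: k phi A => [|k IH] phi A; first by move=> [].
by move=> [phiA [d phid dk]]; split=> //; exists d => //; exact: IH.
Qed.

Lemma deriv_bounded_le k phi A A' L L' : 0 <= L -> A <= A' -> L <= L' ->
  deriv_bounded k phi A L -> deriv_bounded k phi A' L'.
Proof.
move=> L0; elim: k phi A A' => [|k IH] phi A A' AA LL.
  by move=> [H _]; split=> // t; exact: le_trans (H t) AA.
move=> /[dup] /deriv_bounded_ge0 A0 [H [d phid dk]]; split.
  by move=> t; exact: le_trans (H t) AA.
by exists d => //; apply: IH dk => //; apply: ler_pM.
Qed.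

Lemma deriv_boundedD k phi psi A B L :
  deriv_bounded k phi A L -> deriv_bounded k psi B L ->
  deriv_bounded k (fun t => phi t + psi t) (A + B) L.
Proof.
elim: k phi psi A B => [|k IH] phi psi A B [pA p'] [pB q']; (split;
  first by move=> t; apply: le_trans (ler_normD _ _) (lerD _ _)) => //.
case: p' q' => d pd dk [e qe ek]; exists (fun t => d t + e t).
  by move=> t; exact: is_deriveD.
by rewrite mulrDl; exact: IH.
Qed.

(** Leibniz' rule with geometric bounds sums to a binomial expansion, so the rates add. The
    induction only sees its first step, [A * (B * L) + B * (A * K) = A * B * (K + L)]. *)
Lemma deriv_boundedM k phi psi A B K L : 0 <= K -> 0 <= L ->
  deriv_bounded k phi A K -> deriv_bounded k psi B L ->
  deriv_bounded k (fun t => phi t * psi t) (A * B) (K + L).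
Proof.
move=> K0 L0; elim: k phi psi A B => [|k IH] phi psi A B; (move=> pA qB; split;
  first by move=> t; rewrite normrM; apply: ler_pM => //;
    [exact: deriv_bounded_le0 pA _|exact: deriv_bounded_le0 qB _]) => //.
move: (pA) (qB) => [_ [d pd dk]] [_ [e qe ek]].
exists (fun t => phi t * e t + psi t * d t).
  by move=> t; have := is_deriveM (pd t) (qe t).
rewrite (_ : A * B * (K + L) = A * (B * L) + B * (A * K)); last by ring.
apply: deriv_boundedD; first exact: IH (deriv_boundedS pA) ek.
rewrite (_ : (fun t => _) = (fun t => d t * psi t)); last first.
  by apply/funext => t; rewrite mulrC.
by rewrite mulrC; exact: IH dk (deriv_boundedS qB).
Qed.

Lemma deriv_bounded1 k : deriv_bounded k (fun _ => 1) 1 0.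
Proof.
have H0 j : deriv_bounded j (fun _ => 0) 0 0.
  elim: j => [|j IH]; split; rewrite ?normr0//.
  exists (fun _ => 0) => [t|]; first exact: is_derive_cst.
  by rewrite mul0r.
case: k => [|k]; split; rewrite ?normr1//.
exists (fun _ => 0) => [t|]; first exact: is_derive_cst.
by rewrite mul1r.
Qed.

Lemma deriv_bounded_prod (I : Type) (r : seq I) k (phi : I -> R -> R) (L : I -> R) :
  (forall i, 0 <= L i) -> (forall i, deriv_bounded k (phi i) 1 (L i)) ->
  deriv_bounded k (fun t => \prod_(i <- r) phi i t) 1 (\sum_(i <- r) L i).
Proof.
move=> L0 H; elim: r => [|i r IH].
  rewrite big_nil (_ : (fun t => _) = (fun _ => 1)); first exact: deriv_bounded1.
  by apply/funext => t; rewrite big_nil.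
rewrite big_cons (_ : (fun t => _) = (fun t => phi i t * \prod_(j <- r) phi j t)).
  by rewrite -[X in deriv_bounded _ _ X]mulr1; apply: deriv_boundedM => //; exact: sumr_ge0.
by apply/funext => t; rewrite big_cons.
Qed.

Lemma deriv_boundedZ k phi A L c :
  deriv_bounded k phi A L -> deriv_bounded k (fun t => c * phi t) (`|c| * A) L.
Proof.
elim: k phi A => [|k IH] phi A [pA p']; (split;
  first by move=> t; rewrite normrM ler_wpM2l) => //.
case: p' => d pd dk; exists (fun t => c * d t); last by rewrite -mulrA; exact: IH.
by move=> t; exact: is_deriveZ.
Qed.

Lemma is_derive_affine (phi : R -> R) (a b t d : R) :
  is_derive (a + t * b) 1 phi d -> is_derive t 1 (fun t => phi (a + t * b)) (b * d).
Proof.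
move=> pd.
have da : is_derive t 1 (fun t => a + t * b) b.
  have h := is_deriveD (is_derive_cst a t 1) (is_deriveM (is_derive_id t 1) (is_derive_cst b t 1)).
  by apply: is_derive_eq; rewrite scaler0 !add0r /cst /GRing.scale/= mulr1.
have := @is_derive1_comp R phi (fun t => a + t * b) t d b pd da.
by rewrite /GRing.scale/= mulrC.
Qed.

Lemma deriv_bounded_affine k phi A L a b : deriv_bounded k phi A L ->
  deriv_bounded k (fun t => phi (a + t * b)) A (L * `|b|).
Proof.
elim: k phi A => [|k IH] phi A [pA p']; (split; first by move=> t) => //.
case: p' => d pd dk; exists (fun t => b * d (a + t * b)).
  by move=> t; exact: is_derive_affine.
rewrite (_ : A * (L * `|b|) = `|b| * (A * L)); last by ring.
by apply: deriv_boundedZ; exact: IH.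
Qed.

(** By the mean value theorem a unit difference is bounded by the next derivative. Differences
    commute with differentiation, so one order is traded for one factor [L]. *)
Lemma deriv_bounded_diff k phi A L : deriv_bounded k.+1 phi A L ->
  deriv_bounded k (fun t => phi (t + 1) - phi t) (A * L) L.
Proof.
have mvt (psi d : R -> R) (B t : R) : (forall t : R, is_derive t 1 psi (d t)) ->
    (forall t, `|d t| <= B) -> `|psi (t + 1) - psi t| <= B.
  move=> psid dB.
  have tt : t <= t + 1 by rewrite lerDl.
  have ct : {within `[t, t + 1], continuous psi}.
    apply: continuous_subspaceT => x.
    by have [/derivable1_diffP/differentiable_continuous] := psid x.
  have [c _ ->] := MVT_segment tt (fun x _ => psid x) ct.
  by rewrite addrAC subrr add0r mulr1.
have bnd j psi B : deriv_bounded j.+1 psi B L ->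
    forall t, `|psi (t + 1) - psi t| <= B * L.
  by move=> [_ [d pd dk]] t; apply: (mvt _ _ _ t pd); exact: deriv_bounded_le0 dk.
elim: k phi A => [|k IH] phi A dphi; (split; first exact: bnd dphi) => //.
case: dphi => _ [d pd dk].
exists (fun t => d (t + 1) - d t); last exact: IH.
move=> t; apply: is_deriveB.
have := @is_derive_affine phi 1 1 t (d (1 + t * 1)) (pd _).
rewrite mul1r mulr1 (addrC 1 t).
rewrite (_ : (fun t => phi _) = (fun t => phi (t + 1)))//.
by apply/funext => u; rewrite mulr1 addrC.
Qed.

(** Pascal's rule: the difference of order [k.+1] is that of order [k] applied to the first
    differences. *)
Lemma fdiff_sumS k (u : nat -> R) :
  \sum_(j < k.+2) (-1) ^+ (k.+1 - j) * ('C(k.+1, j))%:R * u j =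
  \sum_(j < k.+1) (-1) ^+ (k - j) * ('C(k, j))%:R * (u j.+1 - u j).
Proof.
under [RHS]eq_bigr do rewrite mulrBr.
rewrite sumrB [in LHS]big_ord_recl [X in _ = _ - X]big_ord_recl /= !bin0 !subn0 !mulr1.
under eq_bigr => j _.
  rewrite /bump /= add1n subSS binS natrD mulrDr mulrDl.
  over.
(* The last term of the ['C(k, j.+1)] part vanishes because ['C(k, k.+1) = 0]; the rest is, up to
   sign, the subtracted sum without its index 0 term. *)
rewrite big_split /= big_ord_recr /= (bin_small (ltnSn k)) mulr0 mul0r addr0.
have -> : \sum_(j < k) (-1) ^+ (k - j) * 'C(k, j.+1)%:R * u j.+1 =
   - \sum_(j < k) (-1) ^+ (k - bump 0 j) * 'C(k, bump 0 j)%:R * u (bump 0 j) :> R.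
  rewrite -sumrN; apply: eq_bigr => j _; rewrite /bump /= add1n.
  by rewrite -(subnSK (ltn_ord j)) exprS !mulN1r !mulNr.
by rewrite exprS !mulN1r; ring.
Qed.

(** Taking [k] unit differences in turn costs [k] derivatives and yields [L ^+ k]. Applied to
    [t -> f (x + t h)], this controls the difference of order [M] with step [h]. *)
Lemma deriv_bounded_fdiff k phi A L : deriv_bounded k phi A L ->
  `|\sum_(j < k.+1) (-1) ^+ (k - j) * ('C(k, j))%:R * phi j%:R| <= A * L ^+ k.
Proof.
elim: k phi A => [|k IH] phi A.
  by move=> [pA _]; rewrite big_ord1 bin0 subn0 !expr0 !mul1r mulr1.
move=> /deriv_bounded_diff/IH; rewrite (fdiff_sumS k (fun j => phi j%:R)) exprS mulrA.
by under eq_bigr do rewrite natr1.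
Qed.

(** The free phase [a] closes the induction: differentiating the cosine adds [pi / 2] to it. *)
Lemma deriv_bounded_cos k (a : R) : deriv_bounded k (fun t : R => cos (a + t)) 1 1.
Proof.
elim: k a => [|k IH] a; (split;
  first by move=> t; rewrite ler_norml cos_geN1 cos_le1) => //.
exists (fun t : R => cos (a + pi / 2 + t)); last by rewrite mulr1.
move=> t; rewrite addrAC cosDpihalf.
have := @is_derive_affine cos a 1 t (- sin (a + t * 1)) (is_derive_cos _).
rewrite mul1r mulr1; rewrite (_ : (fun t : R => cos _) = (fun t : R => cos (a + t)))//.
by apply/funext => u; rewrite mulr1.
Qed.

End DerivBounds.

(** * The cutoff *)

Section Bump.
Variable R : realType.

(** Needed at the point where the positive part has its corner: there the difference quotient is at
    most [|h|]. *)
Lemma is_derive0_quadratic (f : R -> R) :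
  (forall h, `|h| <= 1 -> `|f h - f 0| <= h ^+ 2) -> is_derive (0 : R) 1 f 0.
Proof.
move=> fq.
have cv : h^-1 *: ((f \o shift (0 : R)) (h *: (1 : R)) - f 0) @[h --> 0^'] --> (0 : R).
  apply/cvgr0Pnorm_le => e e0; near=> h.
  have h0 : h != 0 by near: h; exact: nbhs_dnbhs_neq.
  have h1 : `|h| <= 1 by near: h; apply: dnbhs0_le.
  have he : `|h| <= e by near: h; apply: dnbhs0_le.
  rewrite /= addr0 /GRing.scale/= mulr1 normrM normfV.
  rewrite ler_pdivrMl ?normr_gt0//; apply: le_trans (fq _ h1) _.
  by rewrite -real_normK ?num_real// expr2 ler_wpM2l.
by apply: DeriveDef; [apply/cvg_ex; exists 0 | apply/cvg_lim].
Unshelve. all: by end_near. Qed.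

Lemma is_derive_pospartX n (x : R) :
  is_derive x 1 (fun y => Num.max 0 y ^+ n.+2) (n.+2%:R * Num.max 0 x ^+ n.+1).
Proof.
have [x0|] := boolP (x < 0).
  rewrite max_l ?(ltW x0)// expr0n mulr0; apply: (@near_eq_is_derive _ _ _ (cst 0)).
  near=> y; rewrite max_l ?expr0n//; apply: ltW; near: y; exact: lt_nbhsl.
rewrite -leNgt le_eqVlt => /predU1P[<-|x0].
  (* At the corner, the exponent is at least 2 and the base lies in [[0, 1]], so the power is at
     most [h ^+ 2]. *)
  rewrite maxxx expr0n mulr0; apply: is_derive0_quadratic => h h1.
  rewrite maxxx expr0n subr0 ger0_norm; last by rewrite exprn_ge0// le_max lexx.
  have h01 : 0 <= Num.max 0 h <= 1.
    by rewrite le_max lexx ge_max ler01/= (le_trans (ler_norm h)).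
  case/andP: h01 => h0 h01.
  apply: (@le_trans _ _ (Num.max 0 h ^+ 2)); first exact: ler_wiXn2l.
  rewrite -[leRHS]real_normK ?num_real// lerXn2r ?nnegrE//.
  by rewrite ge_max normr_ge0 ler_norm.
rewrite max_r ?(ltW x0)//; apply: (@near_eq_is_derive _ _ _ (fun y : R => y ^+ n.+2)).
  near=> y; rewrite max_r//; rewrite -oppr_le0 ltW//; near: y.
  by apply: Nlt_nbhsl; rewrite oppr_lt0.
have := is_deriveX n.+2 (is_derive_id x (1 : R)).
by rewrite exprfctE /GRing.scale/= mulr1.
Unshelve. all: by end_near. Qed.

(** For [b > 0] this is a bump supported in [[-1, 1]] with [b - 1] continuous derivatives. It is
    polynomial on its support, so its derivatives stay explicit; finite smoothness suffices since
    only [M] of them are taken. *)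
Definition cutoff (b : nat) (y : R) : R := Num.max 0 (1 - y ^+ 2) ^+ b.

Lemma cutoff_ge0 b y : 0 <= cutoff b y.
Proof. by rewrite exprn_ge0// le_max lexx. Qed.

Lemma cutoff_base_le1 (y : R) : Num.max 0 (1 - y ^+ 2) <= 1.
Proof. by rewrite ge_max ler01 lerBlDr lerDl sqr_ge0. Qed.

Lemma cutoff_le1 b y : cutoff b y <= 1.
Proof. by rewrite exprn_ile1// ?cutoff_base_le1// le_max lexx. Qed.

Lemma cutoff_supp b y : 1 < `|y| -> cutoff b.+1 y = 0.
Proof.
move=> y1; rewrite /cutoff max_l ?expr0n//.
by rewrite subr_le0 -real_normK ?num_real// exprn_ege1// ltW.
Qed.

Lemma is_derive_cutoff b (y : R) :
  is_derive y 1 (cutoff b.+2) (- (b.+2%:R *+ 2) * (y * cutoff b.+1 y)).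
Proof.
have dg : is_derive y 1 (fun y : R => 1 - y ^+ 2) (- (y *+ 2)).
  have := is_deriveB (is_derive_cst (1 : R) y 1) (is_deriveX 2 (is_derive_id y (1 : R))).
  by rewrite exprfctE /GRing.scale/= mulr1 sub0r expr1 mulr_natl.
have := @is_derive1_comp R (fun u => Num.max 0 u ^+ b.+2) (fun y : R => 1 - y ^+ 2)
  y _ _ (is_derive_pospartX b _) dg.
congr is_derive; rewrite /cutoff/= /GRing.scale/=; ring.
Qed.

(* The family [y ^+ a * cutoff b y] is closed under differentiation, and
   differentiating lowers [a + 2 * b] by one. *)
Lemma deriv_bounded_monomial_cutoff k a b L : (k < b)%N -> (a + 2 * b)%:R <= L ->
  deriv_bounded k (fun y : R => y ^+ a * cutoff b y) 1 L.
Proof.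
have bound a' b' (y : R) : (0 < b')%N -> `|y ^+ a' * cutoff b' y| <= 1.
  case: b' => // b' _; have [y1|y1] := leP `|y| 1.
    rewrite normrM normrX mulr_ile1 ?exprn_ge0// ?exprn_ile1//.
    by rewrite ger0_norm ?cutoff_le1// cutoff_ge0.
  by rewrite cutoff_supp// mulr0 normr0.
elim: k a b L => [|k IH] a b L kb abL; split => //.
- by move=> t; exact: bound.
- by move=> t; apply: bound; exact: leq_trans kb.
(* The bound [k.+1 < b] forces [b >= 2], so the derivative still contains a positive power of the
   cutoff base. *)
case: b => [//|[//|b]] in kb abL *.
(* Product rule. The absolute values of the two coefficients add up to [a + 2 * b], for [b] as
   before the case analysis; this is at most [L] and pays for one derivative. *)
exists (fun y => a%:R * (y ^+ a.-1 * cutoff b.+2 y)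
          + - (b.+2%:R *+ 2) * (y ^+ a.+1 * cutoff b.+1 y)).
  move=> t; have := is_deriveM (is_deriveX a (is_derive_id t (1 : R))) (is_derive_cutoff b t).
  rewrite exprfctE => h; apply: (is_derive_eq h).
  by rewrite /GRing.scale/= exprS; ring.
have L0 : 0 <= L by apply: le_trans abL.
apply: (@deriv_bounded_le _ _ _ (`|a%:R| * 1 + `|- (b.+2%:R *+ 2)| * 1) _ L) => //.
  rewrite !mulr1 mul1r normrN !ger0_norm ?mulrn_wge0//.
  by apply: le_trans abL; rewrite -[_ *+ 2]mulr_natl -natrM -natrD.
apply: deriv_boundedD.
  case: a => [|a] in abL *.
    rewrite (_ : (fun t => _) = (fun t => 0 * (1 * 1))); last first.
      by apply/funext => t; rewrite !mul0r.
    apply: (@deriv_boundedZ _ k (fun=> 1 * 1) 1 L 0); rewrite mulr1.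
    exact: deriv_bounded_le (deriv_bounded1 _ _).
  apply: deriv_boundedZ; apply: IH; first exact: ltn_trans kb.
  by apply: le_trans abL; rewrite ler_nat leq_add2r.
apply: deriv_boundedZ; apply: IH => //.
by apply: le_trans abL; rewrite ler_nat; lia.
Qed.

Lemma deriv_bounded_cutoff k b : (k < b)%N ->
  deriv_bounded k (cutoff b) 1 (2 * b)%:R.
Proof.
move=> kb; have := @deriv_bounded_monomial_cutoff k 0 b (2 * b)%:R kb (lexx _).
by congr deriv_bounded; apply/funext => y; rewrite mul1r.
Qed.

Lemma measurable_cutoff b : measurable_fun setT (cutoff b).
Proof.
apply: measurable_funX; apply: measurable_maxr => //.
by apply: measurable_funB => //; exact: measurable_funX.
Qed.

End Bump.

(** * The oscillating family and its energy *)

Section Osc.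
Context {R : realType}.
Variables (N M : nat) (i0 : 'I_N).
Implicit Types (x h : N.-tuple R) (lam p : R).

Definition osc lam x : R :=
  cos (lam * tnth x i0) * \prod_(i < N) cutoff M.+1 (tnth x i).

(** The indicator of [[-1, 1]^N], as a product over coordinates so that its iterated integral
    factors. *)
Definition box x : R := \prod_(i < N) \1_(`[-1, 1]%classic) (tnth x i).

Lemma measurable_osc lam : measurable_fun setT (osc lam).
Proof.
apply: measurable_funM.
  apply: (measurableT_comp (f := cos : R -> R)).
    by apply: continuous_measurable_fun; exact: continuous_cos.
  by apply: measurable_funM => //; exact: measurable_tnth.
apply: measurable_prod => i _.
by apply: (measurableT_comp (@measurable_cutoff R _)); exact: measurable_tnth.
Qed.

Lemma box_ge0 x : 0 <= box x.
Proof. by apply: prodr_ge0 => i _; rewrite indicE ler0n. Qed.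

Lemma measurable_box : measurable_fun setT box.
Proof.
apply: measurable_prod => i _.
have mi : measurable_fun setT (\1_(`[-1, 1]%classic) : R -> R).
  by apply: measurable_indic; exact: measurable_itv.
by apply: (measurableT_comp mi); exact: measurable_tnth.
Qed.

Lemma iint_box : iint (fun x => (box x)%:E) = (2 ^+ N)%:E.
Proof.
apply: iint_prod_indic; first exact: measurable_itv.
rewrite lebesgue_measure_itv/= lte_fin ifT; last by lra.
by rewrite -EFinB; congr (_%:E); lra.
Qed.

Lemma box01 x : box x = 1 \/ (box x = 0 /\ exists i, 1 < `|tnth x i|).
Proof.
have [/forallP H|] := boolP [forall i, `|tnth x i| <= 1].
  left; apply: big1 => i _; rewrite indicE mem_set//=.
  by rewrite in_itv/= -ler_norml.
rewrite negb_forall => /existsP[i]; rewrite -ltNge => H; right; split; last by exists i.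
apply/eqP/prodf_eq0; exists i => //; rewrite indicE memNset//=.
by rewrite in_itv/= -ler_norml; apply/negP; rewrite -ltNge.
Qed.

Lemma osc_out lam x : box x = 0 -> osc lam x = 0.
Proof.
case: (box01 x) => [->/eqP|[_ [i xi] _]]; first by rewrite oner_eq0.
by rewrite /osc (bigD1 i)//= cutoff_supp// mul0r mulr0.
Qed.

Lemma osc_le_box lam x : `|osc lam x| <= box x.
Proof.
case: (box01 x) => [->|[b0 _]]; last by rewrite osc_out// b0 normr0.
rewrite normrM mulr_ile1//; first by rewrite ler_norml cos_geN1 cos_le1.
rewrite normr_prod prodr_ile1// => i.
by rewrite normr_ge0/= ger0_norm ?cutoff_le1// cutoff_ge0.
Qed.

(** Rate of growth of the derivatives per unit of [lam]: 1 from the cosine and [2 * M.+1] from each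
    of the [N] cutoffs. *)
Definition oscL : R := 1 + (N * (2 * M.+1))%:R.

(** On the line through [x] in direction [h] every factor is a one-variable function composed with
    an affine map, and the rates add. Since [lam >= 1], the rates of the cutoffs are absorbed in
    multiples of [lam]. *)
Lemma deriv_bounded_osc k lam x h : (k <= M)%N -> 1 <= lam ->
  deriv_bounded k (fun t => osc lam (tadd x (tscale t h))) 1 (oscL * lam * tnorm h).
Proof.
move=> kM l1.
have -> : (fun t => osc lam (tadd x (tscale t h))) = (fun t : R =>
    cos (0 + (lam * tnth x i0 + t * (lam * tnth h i0))) *
    \prod_(i < N) cutoff M.+1 (tnth x i + t * tnth h i)).
  apply/funext => t; rewrite /osc !tnth_mktuple add0r; congr (cos _ * _); first by ring.
  by apply: eq_bigr => i _; rewrite !tnth_mktuple.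
have l0 : 0 <= lam by rewrite (le_trans _ l1).
apply: (@deriv_bounded_le _ _ _ (1 * 1) _
  (1 * `|lam * tnth h i0| + \sum_(i < N) (2 * M.+1)%:R * `|tnth h i|)).
- by rewrite addr_ge0 ?mulr_ge0//; apply: sumr_ge0 => i _; rewrite mulr_ge0.
- by rewrite mulr1.
- rewrite mul1r normrM (ger0_norm l0).
  apply: (@le_trans _ _ (lam * tnorm h + \sum_(i < N) (2 * M.+1)%:R * tnorm h)).
    apply: lerD; first by rewrite ler_wpM2l// tnth_le_tnorm.
    by apply: ler_sum => i _; rewrite ler_wpM2l// tnth_le_tnorm.
  rewrite sumr_const card_ord -[_ *+ N]mulr_natl mulrA -natrM /oscL !mulrDl mul1r lerD2l.
  by rewrite ler_wpM2r ?tnorm_ge0// ler_peMr.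
apply: deriv_boundedM => //.
- by apply: sumr_ge0 => i _; rewrite mulr_ge0.
- exact: deriv_bounded_affine (deriv_bounded_cos _ 0).
apply: deriv_bounded_prod => [i|i]; first by rewrite mulr_ge0.
by apply: deriv_bounded_affine; apply: deriv_bounded_cutoff; rewrite ltnS.
Qed.

Lemma oscL_gt0 : 0 < oscL.
Proof. by rewrite /oscL ltr_pwDl. Qed.

(** If all nodes [x + j h] miss the box, the difference is 0, and so is its power because [p > 0].
    Otherwise the sum of boxes is at least 1 and the derivative bound applies. *)
Lemma powR_fdiff_osc_le lam p x h : 0 < p -> 1 <= lam ->
  `|fdiff M h (osc lam) x| `^ p <=
  ((oscL * lam * tnorm h) ^+ M) `^ p * \sum_(j < M.+1) box (tadd x (tscale j%:R h)).
Proof.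
move=> p0 l1.
have S0 : 0 <= \sum_(j < M.+1) box (tadd x (tscale j%:R h)).
  by apply: sumr_ge0 => j _; exact: box_ge0.
have [/forallP H|] := boolP [forall j : 'I_M.+1, box (tadd x (tscale j%:R h)) == 0].
  rewrite /fdiff big1 ?normr0 ?powR0 ?gt_eqF//.
    by rewrite mulr_ge0// powR_ge0.
  by move=> j _; rewrite osc_out ?mulr0//; apply/eqP.
rewrite negb_forall => /existsP[j bj].
have bd : `|fdiff M h (osc lam) x| <= (oscL * lam * tnorm h) ^+ M.
  have := deriv_bounded_fdiff (deriv_bounded_osc x h (leqnn M) l1).
  by rewrite mul1r.
apply: (@le_trans _ _ (((oscL * lam * tnorm h) ^+ M) `^ p)).
  by apply: ge0_ler_powR; rewrite ?nnegrE ?(ltW p0)//; exact: le_trans bd.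
rewrite ler_peMr ?powR_ge0// (bigD1 j)//=.
case: (box01 (tadd x (tscale j%:R h))) bj => [->|[->]]; last by rewrite eqxx.
by move=> _; rewrite lerDl; apply: sumr_ge0 => i _; exact: box_ge0.
Qed.

Lemma iint_powR_osc_le lam p : 0 < p ->
  (iint (fun x => (`|osc lam x| `^ p)%:E) <= (2 ^+ N)%:E)%E.
Proof.
move=> p0; rewrite -iint_box; apply: le_iint => x; rewrite lee_fin ?powR_ge0//.
apply: (@le_trans _ _ (box x `^ p)).
  by apply: ge0_ler_powR; rewrite ?nnegrE ?(ltW p0) ?box_ge0 ?osc_le_box.
by case: (box01 x) => [->|[-> _]]; rewrite ?powR1// powR0// gt_eqF.
Qed.

Lemma iint_sum_box h :
  iint (fun x => (\sum_(j < M.+1) box (tadd x (tscale j%:R h)))%:E) =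
  (M.+1%:R * 2 ^+ N)%:E.
Proof.
have mb (j : 'I_M.+1) : measurable_fun setT (fun x => (box (tadd x (tscale j%:R h)))%:E).
  apply/measurable_EFinP; apply: (measurableT_comp measurable_box).
  exact: measurable_tadd.
under eq_iint do rewrite -sumEFin.
rewrite (iint_sum _ mb); last by move=> j x; rewrite lee_fin box_ge0.
rewrite (eq_bigr (fun _ => (2 ^+ N)%:E)); last first.
  move=> j _; rewrite (@iint_tadd _ _ (fun x => (box x)%:E)) ?iint_box//.
    by apply/measurable_EFinP; exact: measurable_box.
  by move=> x; rewrite lee_fin box_ge0.
by rewrite sumEFin sumr_const card_ord -[_ *+ M.+1]mulr_natl.
Qed.

(* At [t = 0] both sides vanish, by [0 / 0 = 0] on the left. *)
Lemma scaling_identity (s p eps t : R) : (0 < M)%N -> 0 < s -> s < M%:R ->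
  0 < p -> 0 < eps -> 0 <= t ->
  ((oscL * eps `^ (- ((M%:R - s) / M%:R)) * t) ^+ M) `^ p / t `^ (s * p) =
  (oscL ^+ M) `^ p * (eps^-1 * t) `^ (p * (M%:R - s)).
Proof.
move=> M0 s0 sM p0 e0 t0.
have q0 : p * (M%:R - s) != 0 by rewrite mulf_neq0 ?gt_eqF// subr_gt0.
move: t0; rewrite le_eqVlt => /predU1P[<-|t0].
  by rewrite !mulr0 expr0n (gtn_eqF M0) (powR0 q0) powR0 ?gt_eqF// mul0r mulr0.
rewrite !exprMn !powRM ?mulr_ge0 ?exprn_ge0 ?powR_ge0 ?invr_ge0 ?(ltW e0) ?(ltW t0)
  ?(ltW oscL_gt0)//.
rewrite -!mulrA; congr (_ * _).
(* Counting exponents: [(M - s) / M] times [M * p] is [p * (M - s)] for [eps], and [M * p - s * p]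
   gives the same power for [t]. *)
rewrite -[X in (X `^ p)]powR_mulrn ?powR_ge0// -!powRrM.
rewrite -(powR_inv1 (ltW e0)) -powRrM.
congr (_ `^ _ * _); first by field; rewrite gt_eqF// ltr0n.
rewrite -[t ^+ M]powR_mulrn ?(ltW t0)// -powRrM -powRN -powRD; last by rewrite (gt_eqF t0) implybT.
by congr (_ `^ _); ring.
Qed.

(** For fixed [h] the integral in [x] costs [M.+1] boxes of volume [2 ^+ N]. By [scaling_identity]
    what remains depends on [h / eps] only, and a dilation turns it into the moment of [rho]. *)
Lemma BBM_energy_osc_le (rho : N.-tuple R -> R) (s p eps : R) : (0 < M)%N -> 0 < s ->
  s < M%:R -> 0 < p -> 0 < eps -> eps <= 1 ->
  measurable_fun setT rho -> (forall z, 0 <= rho z) ->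
  (BBM_energy rho M s p eps (osc (eps `^ (- ((M%:R - s) / M%:R)))) <=
   ((oscL ^+ M) `^ p * (M.+1%:R * 2 ^+ N))%:E *
   iint (fun z => (rho z * (tnorm z `^ (p * (M%:R - s))))%:E))%E.
Proof.
move=> M0 s0 sM p0 e0 e1 mrho rho0.
set lam := eps `^ _.
(* Here [eps <= 1] enters: [lam] is a nonpositive power of [eps]. *)
have l1 : 1 <= lam.
  have a0 : 0 <= (M%:R - s) / M%:R by rewrite divr_ge0// subr_ge0 ltW.
  rewrite /lam powRN invf_ge1 ?powR_gt0//.
  apply: (@le_trans _ _ (1 `^ ((M%:R - s) / M%:R))); last by rewrite powR1.
  by apply: ge0_ler_powR; rewrite ?nnegrE ?(ltW e0).
pose G z := rho z * (tnorm z `^ (p * (M%:R - s))).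
have G0 z : 0 <= G z by rewrite mulr_ge0// powR_ge0.
have mG : measurable_fun setT G.
  apply: measurable_funM => //.
  by apply: (measurableT_comp (@measurable_powR R _)); exact: measurable_tnorm.
have moll0 h : 0 <= moll rho eps h.
  by rewrite mulr_ge0// invr_ge0 exprn_ge0// ltW.
pose K := (oscL ^+ M) `^ p * (M.+1%:R * 2 ^+ N).
have K0 : 0 <= K by rewrite mulr_ge0 ?powR_ge0// mulr_ge0// exprn_ge0.
have mGs : measurable_fun setT (fun h => (G (tscale eps^-1 h))%:E).
  apply/measurable_EFinP; apply: (measurableT_comp mG); exact: measurable_tscale.
apply: (@le_trans _ _ (iint (fun h => (K * eps ^- N)%:E * (G (tscale eps^-1 h))%:E))%E).
  apply: le_iint => h.
    apply: iint_ge0 => x; rewrite lee_fin.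
    by rewrite divr_ge0 ?powR_ge0// mulr_ge0 ?powR_ge0.
  (* [c] gathers the factors that do not depend on [x]. *)
  pose c := moll rho eps h * (((oscL * lam * tnorm h) ^+ M) `^ p / tnorm h `^ (s * p)).
  have c0 : 0 <= c by rewrite mulr_ge0// divr_ge0 ?powR_ge0.
  apply: (@le_trans _ _ (iint (fun x => c%:E *
      (\sum_(j < M.+1) box (tadd x (tscale j%:R h)))%:E))%E).
    apply: le_iint => x.
      by rewrite lee_fin divr_ge0 ?powR_ge0// mulr_ge0 ?powR_ge0.
    rewrite -EFinM lee_fin /c [in leRHS]mulrA [leRHS]mulrAC.
    rewrite ler_wpM2r ?invr_ge0 ?powR_ge0// -[leRHS]mulrA ler_wpM2l//.
    exact: powR_fdiff_osc_le.
  rewrite iintZl//; last 2 first.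
  - apply/measurable_EFinP; apply: measurable_sum => j.
    by apply: (measurableT_comp measurable_box); exact: measurable_tadd.
  - by move=> x; rewrite lee_fin; apply: sumr_ge0 => j _; exact: box_ge0.
  rewrite iint_sum_box -!EFinM lee_fin /c scaling_identity ?tnorm_ge0//.
  rewrite /G tnorm_tscale ?invr_ge0 ?(ltW e0)// /moll /K.
  by rewrite le_eqVlt; apply/orP; left; apply/eqP; ring.
rewrite iintZl; [|exact: mGs|by move=> h; rewrite lee_fin|
  by rewrite divr_ge0// exprn_ge0// ltW].
(* The dilation by [eps^-1] produces [eps ^+ N], which cancels the normalisation of the
   mollifier. *)
rewrite (@iint_tscale _ _ _ (fun z => (G z)%:E)) ?invr_gt0//.
- rewrite muleA -EFinM exprVn invrK -mulrA mulVf ?mulr1//.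
  by rewrite expf_neq0// gt_eqF.
- exact/measurable_EFinP.
Qed.

End Osc.

(** * Separation *)

Section Separation.
Context {R : realType}.
Variables (N M : nat) (i0 : 'I_N).
Implicit Types (x y h : N.-tuple R) (lam mu tau p : R).
Local Notation osc := (osc M i0).

Definition axis tau : N.-tuple R := [tuple if i == i0 then tau else 0 | i < N].

Definition axis_shift (j : nat) tau x := tadd x (tscale j%:R (axis tau)).

Lemma tnorm_axis tau : 0 <= tau -> tnorm (axis tau) = tau.
Proof.
move=> t0; rewrite /tnorm (bigD1 i0)//= tnth_mktuple eqxx big1 ?addr0.
  by rewrite sqrtr_sqr ger0_norm.
by move=> i ii0; rewrite tnth_mktuple (negbTE ii0) expr0n.
Qed.

Lemma tnth_axis_shift_le j tau x i : 0 <= tau -> `|tnth (axis_shift j tau x) i| <= `|tnth x i| + j%:R * tau.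
Proof.
move=> t0; rewrite !tnth_mktuple; apply: le_trans (ler_normD _ _) _.
rewrite lerD2l normrM ger0_norm// ler_wpM2l//.
by case: ifP => _; rewrite ?normr0// ger0_norm.
Qed.

(* Lower bound of the cutoff product on [-3/4, 3/4]^N: [1 - (3/4)^2 = 7/16]. *)
Definition cutoff_lb : R := ((7 / 16) ^+ M.+1) ^+ N.

Lemma cutoff_lb_gt0 : 0 < cutoff_lb.
Proof. by rewrite !exprn_gt0//; lra. Qed.

Lemma prod_cutoff_ge x : (forall i, `|tnth x i| <= 3 / 4) ->
  cutoff_lb <= \prod_(i < N) cutoff M.+1 (tnth x i).
Proof.
move=> x34; rewrite /cutoff_lb -[in leLHS](card_ord N) -prodr_const.
apply: ler_prod => i _; apply/andP; split; first by rewrite exprn_ge0//; lra.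
rewrite lerXn2r ?nnegrE//; [by rewrite le_max lexx|].
rewrite le_max; apply/orP; right.
have h := x34 i; have n0 := normr_ge0 (tnth x i).
have : `|tnth x i| ^+ 2 <= 9 / 16 by rewrite expr2; nra.
by rewrite real_normK ?num_real//; lra.
Qed.

(** Two unit differences along the axis, each bounded through one derivative; [M0] is read as
    [1 <= M]. The jump by two matches the pairing of shifts 0 with 2 and 1 with 3 below. *)
Lemma osc_axis_shift2_le mu tau x j : (0 < M)%N -> 1 <= mu -> 0 <= tau ->
  `|osc mu (axis_shift j.+2 tau x) - osc mu (axis_shift j tau x)| <= 2 * (oscL N M * mu * tau).
Proof.
move=> M0 mu1 t0.
have := deriv_bounded_osc i0 x (axis tau) M0 mu1.
rewrite tnorm_axis// => /deriv_bounded_diff/deriv_bounded_le0 h.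
have h1 := h j%:R; have h2 := h j.+1%:R.
rewrite !natr1 mul1r in h1 h2.
rewrite mulr_natl mulr2n -[X in `|X|](subrKA (osc mu (axis_shift j.+1 tau x))).
exact: le_trans (ler_normD _ _) (lerD h2 h1).
Qed.

(** Both absolute values are at most 1, hence dominate their squares. *)
Lemma normr_cos_sin_ge1 (t : R) : 1 <= `|cos t| + `|sin t|.
Proof.
have c1 : `|cos t| <= 1 by rewrite ler_norml cos_geN1 cos_le1.
have s1 : `|sin t| <= 1 by rewrite ler_norml sin_geN1 sin_le1.
rewrite -(cos2Dsin2 t) -(real_normK (num_real (cos t))) -(real_normK (num_real (sin t))).
by apply: lerD; rewrite expr2 ler_piMr.
Qed.

(** Quarter-period shifts turn [cos th] into [- sin th], [- cos th] and [sin th]. Shifts 0 and 2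
    thus have opposite signs, as do 1 and 3, so within a pair the fast function jumps by at least
    [2 * cutoff_lb] times [|cos th|] or [|sin th|]. The slow one moves by at most
    [2 * (oscL N M * mu * tau)] per pair, whence the correction with factor 4. *)
Lemma osc_separation lam mu tau x : (0 < M)%N -> 1 <= mu -> 0 <= tau -> lam * tau = pi / 2 ->
  3 * tau <= 2^-1 -> (forall i, `|tnth x i| <= 4^-1) ->
  2 * cutoff_lb <= \sum_(j < 4) `|osc lam (axis_shift j tau x) - osc mu (axis_shift j tau x)| +
    4 * (oscL N M * mu * tau).
Proof.
move=> M0 mu1 t0 ltau t3 x4.
pose g j := \prod_(i < N) cutoff M.+1 (tnth (axis_shift j tau x) i).
(* The shifted coordinates stay within [1/4 + 3 * tau <= 3/4]. *)
have gC j : (j <= 3)%N -> cutoff_lb <= g j.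
  move=> j3; apply: prod_cutoff_ge => i; apply: le_trans (tnth_axis_shift_le _ _ _ t0) _.
  have : j%:R * tau <= 3 * tau by rewrite ler_wpM2r// ler_nat.
  by have := x4 i; lra.
pose th := lam * tnth x i0.
have oscE j : osc lam (axis_shift j tau x) = cos (th + j%:R * (pi / 2)) * g j.
  rewrite /osc /axis_shift; congr (cos _ * _).
  by rewrite !tnth_mktuple eqxx -ltau /th; ring.
have o0 : osc lam (axis_shift 0 tau x) = cos th * g 0 by rewrite oscE mul0r addr0.
have o1 : osc lam (axis_shift 1 tau x) = - sin th * g 1 by rewrite oscE mul1r cosDpihalf.
have o2 : osc lam (axis_shift 2 tau x) = - cos th * g 2.
  by rewrite oscE (_ : 2%:R * _ = pi) ?cosDpi//; field.
have o3 : osc lam (axis_shift 3 tau x) = sin th * g 3.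
  rewrite oscE (_ : th + _ = th + pi / 2 + pi) ?cosDpi ?cosDpihalf ?opprK//; by field.
have big u w : 0 <= cutoff_lb -> forall a b, cutoff_lb <= a -> cutoff_lb <= b ->
    u = a + b -> 2 * cutoff_lb * `|w| <= `|w * u|.
  move=> C0 a b Ca Cb ->; rewrite normrM mulrC ler_wpM2l// ger0_norm; lra.
have C0 := ltW cutoff_lb_gt0.
have b02 : 2 * cutoff_lb * `|cos th| <= `|osc lam (axis_shift 0 tau x) - osc lam (axis_shift 2 tau x)|.
  rewrite o0 o2 mulNr opprK -mulrDr.
  exact: (big _ _ C0 _ _ (gC 0%N isT) (gC 2%N isT) erefl).
have b13 : 2 * cutoff_lb * `|sin th| <= `|osc lam (axis_shift 1 tau x) - osc lam (axis_shift 3 tau x)|.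
  rewrite o1 o3 mulNr -opprD normrN -mulrDr.
  exact: (big _ _ C0 _ _ (gC 1%N isT) (gC 3%N isT) erefl).
have m0 := osc_axis_shift2_le x 0 M0 mu1 t0.
have m1 := osc_axis_shift2_le x 1 M0 mu1 t0.
have tri (a b c d : R) : `|a - b| <= `|a - c| + `|b - d| + `|d - c|.
  have -> : a - b = (a - c) - (b - d) - (d - c) by ring.
  by apply: le_trans (ler_normB _ _) _; rewrite lerD2r; exact: ler_normB.
have := normr_cos_sin_ge1 th.
rewrite -(ler_pM2l (_ : 0 < 2 * cutoff_lb)) ?mulr1; last by rewrite mulr_gt0// cutoff_lb_gt0.
move/le_trans; apply; rewrite !big_ord_recr big_ord0 /= add0r mulrDr.
have t02 := tri (osc lam (axis_shift 0 tau x)) (osc lam (axis_shift 2 tau x))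
  (osc mu (axis_shift 0 tau x)) (osc mu (axis_shift 2 tau x)).
have t13 := tri (osc lam (axis_shift 1 tau x)) (osc lam (axis_shift 3 tau x))
  (osc mu (axis_shift 1 tau x)) (osc mu (axis_shift 3 tau x)).
lra.
Qed.

Lemma iint_axis_shift j tau (f : N.-tuple R -> \bar R) : measurable_fun setT f ->
  (forall x, (0 <= f x)%E) -> iint (fun x => f (axis_shift j tau x)) = iint f.
Proof. exact: iint_tadd. Qed.

Definition locp p (d : N.-tuple R -> R) (r : R) y : R :=
  if tnorm y <= r then `|d y| `^ p else 0.

Lemma locp_ge0 p d r y : 0 <= locp p d r y.
Proof. by rewrite /locp; case: ifP => // _; exact: powR_ge0. Qed.

Lemma measurable_locp p d r : measurable_fun setT d -> measurable_fun setT (locp p d r).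
Proof.
move=> md; apply: measurable_fun_ifT => //.
  by apply: measurable_fun_ler => //; exact: measurable_tnorm.
apply: (measurableT_comp (@measurable_powR R _)).
exact: (measurableT_comp (@normr_measurable R setT)).
Qed.

(** By translation invariance the factor 4 becomes a sum over the four shifts. On the cube
    [[-1/4, 1/4]^N], of volume [2^-N], one of the shifted terms is at least
    [(cutoff_lb / 4) ^ p]. *)
Lemma iint_osc_sub_ge lam mu tau p : (0 < M)%N -> 1 <= mu -> 0 <= tau -> lam * tau = pi / 2 ->
  3 * tau <= 2^-1 -> 4 * (oscL N M * mu * tau) <= cutoff_lb -> 0 < p ->
  (((cutoff_lb / 4) `^ p * (2^-1) ^+ N)%:E <=
   4%:E * iint (fun y => (locp p (fun y => osc lam y - osc mu y)%R N%:R y)%:E))%E.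
Proof.
move=> M0 mu1 t0 ltau t3 small p0; set F := locp _ _ _.
have mF : measurable_fun setT (fun y => (F y)%:E).
  apply/measurable_EFinP; apply: measurable_locp.
  by apply: measurable_funB; exact: measurable_osc.
have F0 y : (0 <= (F y)%:E)%E by rewrite lee_fin locp_ge0.
pose Q := (`[- 4^-1, 4^-1]%classic : set R).
have mQ : measurable Q by exact: measurable_itv.
have muQ : lebesgue_measure Q = (2^-1)%:E.
  rewrite lebesgue_measure_itv/= lte_fin ifT; last by lra.
  by rewrite -EFinB; congr (_%:E); lra.
have -> : (4%:E * iint (fun y => (F y)%:E))%E =
    iint (fun x => (\sum_(j < 4) F (axis_shift j tau x))%:E).
  under [RHS]eq_iint do rewrite -sumEFin.
  rewrite iint_sum; last 2 first.
  - by move=> j; apply: (measurableT_comp mF); exact: measurable_tadd.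
  - by move=> j x; rewrite lee_fin locp_ge0.
  rewrite (eq_bigr (fun=> iint (fun y => (F y)%:E))); last first.
    by move=> j _; rewrite (iint_axis_shift _ _ mF).
  rewrite !big_ord_recr big_ord0/= add0e.
  by rewrite (mule_natl _ 4) -!addeA.
rewrite EFinM -(iint_prod_indic N mQ muQ) -iintZl ?powR_ge0//; last 2 first.
- apply/measurable_EFinP; apply: measurable_prod => i _.
  have mi : measurable_fun setT (\1_Q : R -> R) by exact: measurable_indic.
  by apply: (measurableT_comp mi); exact: measurable_tnth.
- by move=> x; rewrite lee_fin; apply: prodr_ge0 => i _; rewrite indicE ler0n.
apply: le_iint => x.
  by rewrite -EFinM lee_fin mulr_ge0 ?powR_ge0//; apply: prodr_ge0 => i _; rewrite indicE ler0n.
have S0 : 0 <= \sum_(j < 4) F (axis_shift j tau x) by apply: sumr_ge0 => j _; exact: locp_ge0.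
rewrite -EFinM lee_fin.
have [/forallP H|] := boolP [forall i, `|tnth x i| <= 4^-1]; last first.
  rewrite negb_forall => /existsP[i]; rewrite -ltNge => H.
  rewrite (bigD1 i)//= indicE memNset ?mul0r ?mulr0//=.
  by rewrite /Q/= in_itv/= -ler_norml; apply/negP; rewrite -ltNge.
rewrite big1 ?mulr1; last first.
  by move=> i _; rewrite indicE mem_set// /Q/= in_itv/= -ler_norml.
have sep := osc_separation M0 mu1 t0 ltau t3 H.
have [j Dj] : exists j : 'I_4,
    cutoff_lb / 4 <= `|osc lam (axis_shift j tau x) - osc mu (axis_shift j tau x)|.
  (* Pigeonhole: four terms below [cutoff_lb / 4] would sum to less than [cutoff_lb], while [sep]
     and [small] leave at least that much. *)
  apply/not_existsP => Hn; move: sep; rewrite !big_ord_recr big_ord0 /= add0r.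
  have h (j : 'I_4) : `|osc lam (axis_shift j tau x) - osc mu (axis_shift j tau x)| < cutoff_lb / 4.
    by rewrite ltNge; apply/negP; exact: Hn.
  have h0 := h (Ordinal (isT : 0 < 4)%N).
  have h1 := h (Ordinal (isT : 1 < 4)%N).
  have h2 := h (Ordinal (isT : 2 < 4)%N).
  have h3 := h (Ordinal (isT : 3 < 4)%N).
  rewrite /= in h0 h1 h2 h3; lra.
rewrite (bigD1 j)//= -[leLHS]addr0; apply: lerD; last first.
  by apply: sumr_ge0 => i _; exact: locp_ge0.
rewrite /F /locp ifT.
  by apply: ge0_ler_powR; rewrite ?nnegrE ?(ltW p0)// divr_ge0// ltW// cutoff_lb_gt0.
(* The shifted point has coordinates at most [1/4 + 1/2 <= 1], hence lies in the ball of radius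
   [N]. *)
apply: tnorm_le_card => i; apply: le_trans (tnth_axis_shift_le _ _ _ t0) _.
have : j%:R * tau <= 3 * tau by rewrite ler_wpM2r// ler_nat -ltnS.
by have := H i; lra.
Qed.

(** Replaces Minkowski's inequality by the pointwise bound of [|a - b| ^ p] by
    [(2 max(|a|, |b|)) ^ p], at the price of the constant [2 ^ p]. *)
Lemma iint_locpB_le p (f1 f2 g : N.-tuple R -> R) r : 0 < p ->
  measurable_fun setT f1 -> measurable_fun setT f2 -> measurable_fun setT g ->
  (iint (fun y => (locp p (fun y => f1 y - f2 y)%R r y)%:E) <=
   (2 `^ p)%:E * (iint (fun y => (locp p (fun y => f1 y - g y)%R r y)%:E) +
                  iint (fun y => (locp p (fun y => f2 y - g y)%R r y)%:E)))%E.
Proof.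
move=> p0 mf1 mf2 mg.
have m1 : measurable_fun setT (fun y => (locp p (fun y => f1 y - g y)%R r y)%:E).
  by apply/measurable_EFinP; apply: measurable_locp; exact: measurable_funB.
have m2 : measurable_fun setT (fun y => (locp p (fun y => f2 y - g y)%R r y)%:E).
  by apply/measurable_EFinP; apply: measurable_locp; exact: measurable_funB.
have l0 f y : (0 <= (locp p f r y)%:E)%E by rewrite lee_fin locp_ge0.
rewrite -iintD// -iintZl ?powR_ge0//; last 2 first.
- exact: emeasurable_funD.
- by move=> y; exact: adde_ge0.
apply: le_iint => y //.
rewrite -EFinD -EFinM lee_fin /locp; case: ifP => _; last by rewrite addr0 mulr0.
set a := f1 y - g y; set b := f2 y - g y.
have -> : f1 y - f2 y = a - b by rewrite /a /b; ring.
apply: (@le_trans _ _ ((2 * Num.max `|a| `|b|) `^ p)).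
  apply: ge0_ler_powR; rewrite ?nnegrE ?(ltW p0) ?mulr_ge0 ?le_max ?normr_ge0//.
  apply: le_trans (ler_normB _ _) _; rewrite mulr2n mulrDl !mul1r.
  by apply: lerD; rewrite le_max lexx ?orbT.
rewrite powRM ?le_max ?normr_ge0// ler_wpM2l ?powR_ge0//.
by have [_|_] := leP `|a| `|b|; rewrite ?lerDl ?lerDr powR_ge0.
Qed.

End Separation.

(** Convergence would bring two late terms close to [g], hence to each other. Freezing one and
    giving the other a much higher frequency contradicts [iint_osc_sub_ge]. *)
Lemma osc_not_cvg (R : realType) (N M : nat) (i0 : 'I_N) (p : R) (lam : nat -> R)
    (g : N.-tuple R -> R) :
  (0 < M)%N -> 0 < p -> (forall k, 1 <= lam k) ->
  (forall B, 0 <= B -> exists K, forall k, (K <= k)%N -> B <= lam k) ->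
  measurable_fun setT g ->
  ~ ((fun k => iint (fun y => (locp p (fun y => osc M i0 (lam k) y - g y) N%:R y)%:E))
      @ \oo --> 0%E).
Proof.
move=> M0 p0 lam1 laminf mg.
set a := (X in X @ _ --> _) => a_cvg.
have C0 : 0 < cutoff_lb N M :> R := cutoff_lb_gt0 N M.
have L0 : 0 < oscL N M :> R := oscL_gt0 N M.
pose c : R := (cutoff_lb N M / 4) `^ p * (2^-1) ^+ N.
have c0 : 0 < c by rewrite mulr_gt0 ?exprn_gt0 ?powR_gt0 ?divr_gt0.
have P0 : 0 < 2 `^ p :> R by rewrite powR_gt0.
(* Chosen so that [4 * 2 ^ p * (d + d) = c / 2 < c]. *)
pose d := c / (16 * 2 `^ p).
have d0 : 0 < d by rewrite divr_gt0// mulr_gt0.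
have [K _ aK] : \forall k \near \oo, (a k < d%:E)%E.
  have : nbhs 0%E [set y | (y < d%:E)%E] by exact: (@nbhs_open_ereal_lt R 0 (fun=> d) d0).
  exact: a_cvg.
pose mu := lam K.
(* With [tau = pi / (2 lam)], the first summand ensures [3 * tau <= 1/2] and the second
   [4 * (oscL N M * mu * tau) <= cutoff_lb]. [B] depends on [mu], so the slow frequency is fixed
   first. *)
pose B := 3 * pi + 2 * pi * oscL N M * mu / cutoff_lb N M : R.
have pi0 : 0 < pi :> R := pi_gt0 R.
have mu0 : 0 < mu by apply: lt_le_trans (lam1 K).
have B0 : 0 <= 2 * pi * oscL N M * mu / cutoff_lb N M by rewrite ltW// divr_gt0// !mulr_gt0.
have B3 : 3 * pi <= B by rewrite lerDl.
have [|K' BK'] := laminf B; first by rewrite addr_ge0// mulr_ge0// ltW.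
pose k := maxn K K'.
have Bk : B <= lam k by apply: BK'; rewrite leq_maxr.
have lk0 : 0 < lam k by apply: lt_le_trans (lam1 k).
pose tau := pi / 2 / lam k.
have ltau : lam k * tau = pi / 2 by rewrite /tau; field; rewrite gt_eqF.
have tau0 : 0 <= tau by rewrite !divr_ge0// ltW.
have tau3 : 3 * tau <= 2^-1.
  have h : 3 * pi <= lam k by exact: le_trans Bk.
  by rewrite -(ler_pM2l lk0) mulrCA ltau; lra.
have small : 4 * (oscL N M * mu * tau) <= cutoff_lb N M.
  have : 2 * pi * oscL N M * mu / cutoff_lb N M <= lam k.
    by apply: le_trans Bk; rewrite lerDr mulr_ge0// ltW.
  rewrite ler_pdivrMr// => h.
  rewrite -(ler_pM2l lk0); apply: le_trans h.
  rewrite le_eqVlt; apply/orP; left; apply/eqP.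
  rewrite (_ : lam k * _ = 4 * oscL N M * mu * (lam k * tau)); last by ring.
  by rewrite ltau; field.
have := iint_osc_sub_ge i0 M0 (lam1 K) tau0 ltau tau3 small p0.
apply/negP; rewrite -ltNge.
have m l : measurable_fun setT (osc M i0 (l : R)) by exact: measurable_osc.
have l1 := iint_locpB_le N%:R p0 (m (lam k)) (m (lam K)) mg.
have ak := aK k (leq_maxl _ _); have aK' := aK K (leqnn K).
apply: (@le_lt_trans _ _ (4%:E * ((2 `^ p)%:E * (d%:E + d%:E)))%E).
  apply: lee_wpmul2l => //; apply: le_trans l1 _.
  by apply: lee_wpmul2l; [rewrite lee_fin ltW|apply: leeD; apply: ltW].
rewrite -EFinD -!EFinM lte_fin -/c.
rewrite (_ : 4 * _ = c / 2); first by lra.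
by rewrite /d; field; rewrite gt_eqF.
Qed.

(** * The family indexed by [eps], and its sequence of parameters [1 / (k + 1)] *)

Theorem theorem2p15 (R : realType) (N M : nat) (s p : R)
  (rho : N.-tuple R -> R) :
  (0 < N)%N -> (0 < M)%N -> 0 < s -> s < M%:R -> 1 <= p ->
  (* rho in L^1(R^N), and (rho_eps) is a family of mollifiers *)
  measurable_fun setT rho ->
  (iint (fun z => (`| rho z |)%:E) < +oo)%E ->
  (forall z, 0 <= rho z) ->
  iint (fun z => (rho z)%:E) = 1%E ->
  (* moment condition *)
  (iint (fun z => (rho z * (tnorm z `^ (p * (M%:R - s))))%:E) < +oo)%E ->
  exists f : R -> N.-tuple R -> R,
    (* (f_eps)_{eps>0} is a bounded family in L^p(R^N) *)
    (forall eps, 0 < eps -> measurable_fun setT (f eps)) /\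
    (exists C : R, forall eps, 0 < eps ->
        (iint (fun x => (`| f eps x | `^ p)%:E) <= C%:E)%E) /\
    (* limsup_{eps -> 0+} of the energy is finite *)
    (exists C : R, \forall eps \near 0^'+,
        (BBM_energy rho M s p eps (f eps) <= C%:E)%E) /\
    (* (f_eps) is not relatively compact in L^p_loc(R^N) as eps -> 0+:
       some sequence eps_k -> 0+ admits no subsequence converging in L^p_loc *)
    (exists e : nat -> R, (forall k, 0 < e k) /\ e @ \oo --> 0 /\
       forall (phi : nat -> nat) (g : N.-tuple R -> R),
         {homo phi : m n / (m < n)%N >-> (m < n)%N} ->
         measurable_fun setT g ->
         (forall r, 0 < r ->
            (iint (fun x => (if tnorm x <= r then `| g x | `^ p else 0)%:E) < +oo)%E) ->
         ~ (forall r, 0 < r ->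
              (fun k => iint (fun x =>
                 (if tnorm x <= r then `| f (e (phi k)) x - g x | `^ p else 0)%:E))
              @ \oo --> 0%E)).
Proof.
move=> N0 M0 s0 sM p1 mrho _ rho0 _ moment.
have p0 : 0 < p by apply: lt_le_trans p1.
pose i0 : 'I_N := Ordinal N0.
pose q := (M%:R - s) / M%:R.
have q0 : 0 < q by rewrite divr_gt0 ?subr_gt0 ?ltr0n.
exists (fun eps => osc M i0 (eps `^ (- q))); split.
  by move=> eps _; exact: measurable_osc.
split; first by exists (2 ^+ N) => eps _; exact: iint_powR_osc_le.
split.
  pose G z := (rho z * (tnorm z `^ (p * (M%:R - s))))%:E.
  (* The moment condition makes [iint G] finite, so [fine] loses nothing. *)
  exists ((oscL N M ^+ M) `^ p * (M.+1%:R * 2 ^+ N) * fine (iint G)); near=> eps.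
  rewrite EFinM fineK; last first.
    rewrite ge0_fin_numE//; apply: iint_ge0 => z.
    by rewrite lee_fin mulr_ge0// powR_ge0.
  apply: BBM_energy_osc_le => //.
  by near: eps; exact: nbhs_right_le.
exists (fun k => k.+1%:R^-1); split; first by move=> k; rewrite invr_gt0.
split; first exact: cvg_harmonic.
(* Convergence is refuted on the single ball of radius [N]. *)
move=> phi g phi_incr mg _ /(_ N%:R); rewrite ltr0n => /(_ N0).
have phi_ge k : (k <= phi k)%N.
  elim: k => // k IH; exact: leq_ltn_trans IH (phi_incr _ _ (ltnSn k)).
have lamE k : (k.+1%:R^-1 : R) `^ (- q) = k.+1%:R `^ q.
  by rewrite -powR_inv1 // -powRrM mulrN mulN1r opprK.
apply: osc_not_cvg => //.
  move=> k; rewrite lamE; apply: (@le_trans _ _ (1 `^ q)); first by rewrite powR1.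
  by apply: ge0_ler_powR; rewrite ?nnegrE ?(ltW q0)// ler1n.
(* The frequency at index [k] is [(phi k + 1) ^ q], with [phi k >= k]; it exceeds [B] once [k]
   exceeds [B ^ (1 / q)]. *)
move=> B B0; exists (Num.truncn (B `^ q^-1)).+1 => k Kk; rewrite lamE.
have -> : B = (B `^ q^-1) `^ q by rewrite -powRrM mulVf ?gt_eqF// powRr1.
apply: ge0_ler_powR; rewrite ?nnegrE ?powR_ge0 ?(ltW q0)//.
apply: (@le_trans _ _ (Num.truncn (B `^ q^-1)).+1%:R); first by rewrite ltW// truncnS_gt.
by rewrite ler_nat; apply: leqW; apply: leq_trans (phi_ge k).
Unshelve. all: by end_near. Qed.
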